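(* Let $D$ be a pre-divergence on a Polish space $\mathcal{X}$, $c$ a cost function, and $\mu\in\mathcal{P}(\mathcal{X})$, and assume $P\mapsto D(P\|\mu)$ is lower semicontinuous and has compact sublevel sets. Then $\nu\mapsto D^c(\nu\|\mu)$ is lower semicontinuous on $\mathcal{P}(\mathcal{X})$.
   Context: $\mathcal{P}(\mathcal{X})$ is the set of Borel probability measures on the Polish space $\mathcal{X}$ with the weak (Prokhorov) topology. A pre-divergence is $D:\mathcal{P}(\mathcal{X})\times\mathcal{P}(\mathcal{X})\to[0,\infty]$ with $D(\mu\|\mu)=0$ for all $\mu$. A cost function is a lower semicontinuous $c:\mathcal{X}\times\mathcal{X}\to[0,\infty]$, with OT cost $C(\mu,\nu)=\inf\{\int c\,d\pi:\pi_1=\mu,\pi_2=\nu\}$. $D^c(\nu\|\mu)=\inf_{\eta\in\mathcal{P}(\mathcal{X})}\{D(\eta\|\mu)+C(\eta,\nu)\}$. *)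

(* Defs.v *)
From HB Require Import structures.
From mathcomp Require Import all_boot all_order all_algebra.
From mathcomp Require Import all_classical all_reals all_analysis.
Set Implicit Arguments.
Unset Strict Implicit.
Unset Printing Implicit Defensive.
Import Order.TTheory GRing.Theory Num.Theory.
Import numFieldNormedType.Exports.
Local Open Scope classical_set_scope.
Local Open Scope ring_scope.

(* A Polish space: a (pointed) complete metric space that is Hausdorff
   (so the pseudometric is a genuine metric) and separable. *)
Definition polish {R : realType} (X : completePseudoMetricType R) : Prop :=
  hausdorff_space X /\ exists S : set X, countable S /\ dense S.

Definition borel (X : ptopologicalType) := g_sigma_algebraType (@open X).

Definition bcfun (R : realType) (X : ptopologicalType) :=
  {f : X -> R | continuous f /\ exists M : R, forall x, `|f x| <= M}.

Definition integrals_bc (R : realType) (X : ptopologicalType)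
  (P : probability (borel X) R) : {ptws bcfun R X -> R} :=
  fun f => fine (\int[P]_x ((proj1_sig f) x)%:E)%E.

(* P(X) with the weak (narrow) topology: the initial topology making all
   P |-> \int f dP (f bounded continuous) continuous. *)
Definition weakP (R : realType) (X : ptopologicalType) :=
  initial_topology (@integrals_bc R X).

Definition coupling (R : realType) (X : ptopologicalType)
  (mu nu : probability (borel X) R)
  (pi : probability (borel X * borel X)%type R) : Prop :=
  (forall A : set (borel X), measurable A -> pi (fst @^-1` A) = mu A) /\
  (forall A : set (borel X), measurable A -> pi (snd @^-1` A) = nu A).

Definition ot_cost (R : realType) (X : ptopologicalType)
  (c : X * X -> \bar R) (mu nu : probability (borel X) R) : \bar R :=
  ereal_inf [set (\int[pi]_z c z)%E | pi in coupling mu nu].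

Definition Dc (R : realType) (X : ptopologicalType)
  (D : probability (borel X) R -> probability (borel X) R -> \bar R)
  (c : X * X -> \bar R) (nu mu : probability (borel X) R) : \bar R :=
  ereal_inf [set (D eta mu + ot_cost c eta nu)%E | eta in [set: probability (borel X) R]].

(* Main.v *)
Require Import Defs.
From HB Require Import structures.
From mathcomp Require Import all_boot all_order all_algebra.
From mathcomp Require Import all_classical all_reals all_analysis.
From mathcomp Require Import lra measurable_realfun.
Import Order.TTheory GRing.Theory Num.Theory.
Import numFieldNormedType.Exports.
Local Open Scope classical_set_scope.
Local Open Scope ring_scope.

Set Implicit Arguments.
Unset Strict Implicit.
Unset Printing Implicit Defensive.

(* The optimal transport cost is jointly lower semicontinuous for the weak
   topology; with the compactness of the sublevel sets of [D _ mu] and a tube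
   argument the theorem follows.

   For joint lower semicontinuity, suppose couplings of cost at most t have
   marginals approaching (eta0, nu0) along an ultrafilter. Their limits on Borel
   sets form a finitely additive [b]. The outer measure
     A |-> inf { sum_k b (G_k) | A covered by open sets G_0, G_1, ... }
   is a metric outer measure, so Borel sets are measurable for it by
   Caratheodory's criterion. It has total mass 1 because eta0 and nu0 are tight
   (Ulam), it is at most [b] on open sets, and hence its marginals are at most,
   so equal to, eta0 and nu0. Being at most [b] on the open sets {c > s}, it
   gives c an integral at most t. No duality or Prokhorov theorem is needed. *)

(** * Metric outer measures *)

(** Distance at least [e] between the two sets, expressed through balls. *)
Definition separated_by {R : realType} {Z : pseudoMetricType R} (e : R) (A B : set Z) :=
  forall x y, A x -> ball x e y -> ~ B y.

(** For [e > 0], the points of [G] at distance at least [e] from its complement. Despite the name,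
    this set need not be open. *)
Definition ball_interior {R : realType} {Z : pseudoMetricType R} (G : set Z) (e : R) :=
  [set z | ball z e `<=` G].

Lemma ball_interior_mono (R : realType) (Z : pseudoMetricType R) (G : set Z) (e e' : R) :
  e <= e' -> ball_interior G e' `<=` ball_interior G e.
Proof. by move=> ee' z zG w /(le_ball ee') /zG. Qed.

Lemma ball_interior_separated (R : realType) (Z : pseudoMetricType R) (G : set Z) (e e' : R) :
  separated_by e (ball_interior G (e + e')) (~` ball_interior G e').
Proof.
by move=> x y Gx xy; apply=> w yw; apply: Gx; exact: ball_triangle xy yw.
Qed.

Definition radius {R : realType} (n : nat) : R := n.+1%:R^-1.

Lemma radius_gt0 (R : realType) n : 0 < radius n :> R.
Proof. by rewrite invr_gt0 ltr0n. Qed.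

Lemma ltr_radiusS (R : realType) n : radius n.+1 < radius n :> R.
Proof. by rewrite /radius ltf_pV2 ?posrE ?ltr0n// ltr_nat. Qed.

Lemma ler_radius (R : realType) n m : (n <= m)%N -> radius m <= radius n :> R.
Proof. by move=> nm; rewrite /radius lef_pV2 ?posrE ?ltr0n// ler_nat. Qed.

Lemma bigcup_ball_interior (R : realType) (Z : pseudoMetricType R) (G : set Z) :
  open G -> \bigcup_n ball_interior G (radius n) = G.
Proof.
move=> oG; apply/seteqP; split => [z [n _]|z Gz].
  by apply; apply: ballxx; exact: radius_gt0.
have /nbhs_ballP[e /= e0 eG] : nbhs z G by exact: open_nbhs_nbhs.
have [n ne] := ltr_add_invr (e0 : 0 < e); rewrite add0r in ne.
by exists n => // w /(le_ball (ltW ne)) /eG.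
Qed.

(* Caratheodory's criterion for metric outer measures: the part of [X `&` G]
   outside [ball_interior G (radius n)] is covered by shells [S k], [k >= n],
   and every second shell is separated, so their measures are summable. *)
Lemma metric_outer_measure_open (R : realType) (Z : pseudoMetricType R)
    (mu : {outer_measure set Z -> \bar R}) (G : set Z) :
  (forall A B (e : R), 0 < e -> separated_by e A B -> (mu A + mu B <= mu (A `|` B))%E) ->
  open G -> mu.-caratheodory G.
Proof.
move=> mu_metric oG; apply: le_caratheodory_measurable => X.
have [->|/eqP Xoo] := eqVneq (mu X) +oo%E; first exact: leey.
have Xfin : (mu X < +oo)%E by rewrite ltey; apply/eqP.
pose I n : set Z := ball_interior G (radius n).
pose S k : set Z := (X `&` G) `&` (I k.+2 `\` I k.+1).
have Imono n m : (n <= m)%N -> I n `<=` I m.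
  by move=> nm; apply: ball_interior_mono; exact: ler_radius.
have Isep n : separated_by (radius n - radius n.+1) (I n) (~` I n.+1).
  have := @ball_interior_separated R Z G (radius n - radius n.+1) (radius n.+1).
  by rewrite subrK.
have rpos n : 0 < radius n - radius n.+1 :> R by rewrite subr_gt0 ltr_radiusS.
have IG n : I n `<=` G.
  by move=> z; apply; apply: ballxx; exact: radius_gt0.
have muXle A : A `<=` X -> (mu A <= mu X)%E by exact: le_outer_measure.
(* [S n] is at positive distance from [I n], and both meet [X] inside [I n.+2], so each step
   enlarges one of the two terms. The terms track the even and the odd shells. *)
have partial n : (\sum_(0 <= k < n) mu (S k) <= mu (X `&` I n) + mu (X `&` I n.+1))%E.
  elim: n => [|n IH]; first by rewrite big_nil adde_ge0 ?outer_measure_ge0.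
  rewrite big_nat_recr//= [leRHS]addeC.
  apply: (le_trans (leeD2r _ IH)); rewrite addeAC; apply: leeD2r.
  apply: (le_trans (mu_metric _ _ _ (rpos n) _)).
    by move=> x y [_ Ix] xy [_ [_]]; exact: Isep xy.
  apply: le_outer_measure => z [[Xz Iz]|[[Xz _] [Iz _]]]; split => //.
  by apply: Imono Iz; rewrite ltnW.
have sumS : (\sum_(0 <= k <oo) mu (S k) < +oo)%E.
  apply: (@le_lt_trans _ _ (mu X + mu X)%E); last by rewrite lte_add_pinfty.
  apply: lime_le; first by apply: is_cvg_nneseries => *; exact: outer_measure_ge0.
  apply: nearW => n; apply: (le_trans (partial n)).
  by apply: leeD; apply: muXle; exact: subIsetl.
have bound n : (mu (X `&` G) + mu (X `&` ~` G) <=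
    \sum_(n <= k <oo) mu (S k) + mu X)%E.
  have cover : (mu (X `&` G) <= mu (X `&` I n.+1) + \sum_(n <= k <oo) mu (S k))%E.
    pose F k := if k is k'.+1 then S (k' + n)%N else X `&` I n.+1.
    have -> : (mu (X `&` I n.+1) + \sum_(n <= k <oo) mu (S k))%E =
        (\sum_(0 <= k <oo) mu (F k))%E.
      rewrite [RHS](nneseries_recl (P := xpredT))//; last first.
        by move=> k _; exact: outer_measure_ge0.
      congr (_ + _)%E; rewrite -(nneseries_addn n); last first.
        by move=> k; exact: outer_measure_ge0.
      rewrite -[in RHS](nneseries_addn (f := fun k => mu (F k)) 1); last first.
        by move=> k; exact: outer_measure_ge0.
      by apply: eq_eseriesr => k _; rewrite addn1.
    apply: le_trans (outer_measure_sigma_subadditive mu F).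
    apply: le_outer_measure => z [Xz Gz].
    have : (\bigcup_n I n) z by rewrite bigcup_ball_interior.
    move=> [m _ Imz].
    have [/asboolP Iz|/asboolP nIz] := boolP `[< I n.+1 z >]; first by exists 0%N.
    (* The least [m] with [I m z] is at least [n.+2]. Writing it as [k.+2] puts [z] in the shell
       [S k], which is [F (k - n).+1]. *)
    have ex : exists m, `[< I m z >] by exists m; apply/asboolP.
    case: (ex_minnP ex) => k /asboolP Ikz kmin.
    have nk : (n.+1 < k)%N.
      by rewrite ltnNge; apply/negP => kn; apply: nIz; exact: Imono Ikz.
    case: k => [|[|k]]// in Ikz kmin nk *.
    exists (k - n).+1 => //=; rewrite subnK; last exact: nk.
    do 2 split=> //; first by move=> Ik1; have := kmin k.+1 (asboolT Ik1); rewrite ltnn.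
  apply: (le_trans (leeD2r _ cover)); rewrite addeAC [leRHS]addeC; apply: leeD2r.
  apply: le_trans (mu_metric _ _ _ (rpos n.+1) _) _.
    move=> x y [_ Ix] xy [_ nGy]; apply: (Isep _ _ _ Ix xy) => Iy.
    exact/nGy/(IG _ _ Iy).
  by apply: muXle => z [[]|[]].
have tail := nneseries_tail_cvg sumS (fun k _ => outer_measure_ge0 mu (S k)).
have lim_bound : ((\sum_(n <= k <oo) mu (S k) + mu X)%E @[n --> \oo] --> mu X)%E.
  rewrite -[X in _ --> X]add0e; apply: cvgeD => //; last exact: cvg_cst.
by apply: cvge_ge lim_bound; exact: nearW.
Qed.

(** * The outer measure generated by open sets *)

(** Joins the pointed and the pseudometric structure of a product, so that [open_outer_metric] can
    be used on [X * X]. *)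
HB.instance Definition _ (R : realType) (X Y : pseudoPMetricType R) :=
  PseudoMetric.on (X * Y)%type.

(* Taking [+oo] off the open sets makes [mu_ext] range over open covers only. *)
Definition open_weight {R : realType} {Z : ptopologicalType} (b : set Z -> R)
  (A : set Z) : \bar R := if `[< open A >] then (b A)%:E else +oo%E.

Definition open_outer {R : realType} {Z : ptopologicalType} (b : set Z -> R) :=
  @mu_ext _ (borel Z) R (open_weight b).

(** Finite additivity on open sets, split into superadditivity on disjoint pairs and subadditivity.
    Ultrafilter limits of measures have this form, while countable additivity can fail for them. *)
Definition open_content {R : realType} {Z : ptopologicalType} (b : set Z -> R) :=
  [/\ b set0 = 0, forall A, 0 <= b A,
      forall A B, open A -> open B -> A `<=` B -> b A <= b B,
      forall A B, open A -> open B -> A `&` B = set0 -> b A + b B <= b (A `|` B) &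
      forall A B, open A -> open B -> b (A `|` B) <= b A + b B].

Lemma open_weightE (R : realType) (Z : ptopologicalType) (b : set Z -> R) A :
  open A -> open_weight b A = (b A)%:E.
Proof. by move=> oA; rewrite /open_weight; case: asboolP. Qed.

Section open_outer_measure.
Variables (R : realType) (Z : ptopologicalType) (b : set Z -> R).
Hypothesis bP : open_content b.

Lemma open_weight0 : open_weight b set0 = 0%E.
Proof. by have [b0 _ _ _ _] := bP; rewrite open_weightE ?b0//; exact: open0. Qed.

Lemma open_weight_ge0 A : (0 <= open_weight b A)%E.
Proof.
have [_ b_ge0 _ _ _] := bP.
by rewrite /open_weight; case: asboolP => _; rewrite ?leey ?lee_fin.
Qed.

Lemma open_outer_le G : open G -> (open_outer b G <= (b G)%:E)%E.
Proof.
move=> oG; apply: ereal_inf_lbound.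
exists (fun k => if k is 0%N then G else set0).
  split=> [[|k]|z Gz]; last by exists 0%N.
  - exact: sub_sigma_algebra.
  - exact: measurable0.
rewrite nneseries_recl//; last by move=> k _; exact: open_weight_ge0.
rewrite open_weightE// eseries0 ?adde0// => -[|k]// _ _.
exact: open_weight0.
Qed.

(** Compactness makes up for countable subadditivity of [b]: finitely many members of an open cover
    already contain [K], and for them finite subadditivity suffices. *)
Lemma open_outer_setT_ge (t : R) :
  (exists2 K : set Z, compact K & forall W, open W -> K `<=` W -> t <= b W) ->
  (t%:E <= open_outer b setT)%E.
Proof.
move=> [K /compact_near_coveringP cK bK]; have [b0 b_ge0 b_mono _ b_sub] := bP.
apply: le_ereal_inf_tmp => _ [F [_ FT] <-].
have [oF|] := pselect (forall k, open (F k)); last first.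
  (* A member that is not open has weight [+oo], and so has the whole cover. *)
  move=> /existsNP[k nFk].
  by rewrite (eseries_pinfty _ (k := k))// ?leey// => [n _|];
    [rewrite -ltNye (lt_le_trans _ (open_weight_ge0 _))|rewrite /open_weight; case: asboolP].
have oU n : open (\bigcup_(k in `I_n) F k) by apply: bigcup_open => k _; exact: oF.
have [N _ /(_ N (leqnn N)) KN] : \forall n \near \oo, K `<=` \bigcup_(k in `I_n) F k.
  apply: cK => z Kz; have [k _ Fkz] := FT z I.
  exists (F k, [set n | (k < n)%N]).
    split; first by apply: open_nbhs_nbhs; split; first exact: oF.
    by exists k.+1.
  by move=> [z' n] [/= Fz' kn]; exists k.
have bU n : (b (\bigcup_(k in `I_n) F k))%:E = open_weight b (\bigcup_(k in `I_n) F k).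
  by rewrite open_weightE.
apply: (@le_trans _ _ (b (\bigcup_(k in `I_N) F k))%:E); first by rewrite lee_fin bK.
apply: le_trans (nneseries_lim_ge N _); last by move=> k _ _; exact: open_weight_ge0.
elim: {KN} N => [|n IH].
  by rewrite II0 bigcup_set0 b0 big_nil.
rewrite big_nat_recr//= IIS bigcup_setU bigcup_set1 open_weightE//.
apply: le_trans (leeD2r _ IH).
by rewrite -EFinD lee_fin b_sub.
Qed.

End open_outer_measure.

(** The neighbourhoods [N A] and [N B] of radius [e / 2] are open and disjoint. Intersecting a cover
    of the union with each of them gives covers of [A] and of [B], and [b] is superadditive on the
    two pieces of each open member. *)
Lemma open_outer_metric (R : realType) (Z : pseudoPMetricType R) (b : set Z -> R)
    (A B : set Z) (e : R) : open_content b -> 0 < e -> separated_by e A B ->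
  (open_outer b A + open_outer b B <= open_outer b (A `|` B))%E.
Proof.
move=> bP e0 AB; have [b0 b_ge0 b_mono b_add _] := bP.
pose N (C : set Z) := \bigcup_(c in C) (ball c (e / 2))°.
have oN C : open (N C) by apply: bigcup_open => c _; exact: open_interior.
have subN C : C `<=` N C.
  move=> c Cc; exists c => //; apply: nbhs_singleton.
  by apply: nbhs_interior; apply: nbhsx_ballx; rewrite divr_gt0.
have NAB : N A `&` N B = set0.
  rewrite -subset0 => z [[x Ax /interior_subset xz] [y By /interior_subset yz]].
  exact: AB Ax (ball_splitl xz yz) By.
apply: le_ereal_inf_tmp => _ [F [mF ABF] <-].
have mN C : measurable (N C : set (borel Z)) by exact: sub_sigma_algebra.
have le_N C : C `<=` A `|` B ->
    (open_outer b C <= \sum_(0 <= k <oo) open_weight b (F k `&` N C))%E.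
  move=> CAB; apply: ereal_inf_lbound; exists (fun k => F k `&` N C) => //.
  split=> [k|z Cz]; first exact: measurableI.
  by have [k _ Fkz] := ABF z (CAB z Cz); exists k => //; split => //; exact: subN.
apply: (le_trans (leeD (le_N A _) (le_N B _))) => //.
rewrite -nneseriesD; try by move=> *; exact: open_weight_ge0.
apply: lee_nneseries => [k _ _|k _]; first by rewrite adde_ge0// open_weight_ge0.
have [oF|nF] := pselect (open (F k)); last first.
  by rewrite [leRHS]/open_weight; case: asboolP => // _; rewrite leey.
have oFN C : open (F k `&` N C) by exact: openI.
rewrite !open_weightE// -EFinD lee_fin.
apply: (@le_trans _ _ (b ((F k `&` N A) `|` (F k `&` N B)))).
  by apply: b_add => //; rewrite setIACA NAB setI0.
by apply: b_mono => //; [exact: openU|move=> z [[]|[]]].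
Qed.

(* The limit measure. It may be strictly smaller than [b] on open sets, because
   mass can escape to the boundary. *)
Lemma open_content_measure (R : realType) (X : pseudoPMetricType R)
    (b : set (X * X) -> R) :
  open_content b -> b setT <= 1 ->
  (forall e : R, 0 < e -> exists2 K : set (X * X), compact K &
     forall W, open W -> K `<=` W -> 1 - e <= b W) ->
  exists pi : probability (borel X * borel X)%type R,
    forall G : set (X * X), open G -> (pi G <= (b G)%:E)%E.
Proof.
move=> bP b1 btight; have [_ b_ge0 _ _ _] := bP.
pose out : set (X * X) -> \bar R := open_outer b.
pose outM := isOuterMeasure.Build R (X * X)%type out
  (mu_ext0 (T := borel (X * X)%type) (open_weight0 bP) (open_weight_ge0 bP))
  (mu_ext_ge0 (T := borel (X * X)%type) (open_weight_ge0 bP))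
  (le_mu_ext (T := borel (X * X)%type) (open_weight b))
  (mu_ext_sigma_subadditive (T := borel (X * X)%type) (open_weight_ge0 bP)).
pose mu : {outer_measure set (X * X)%type -> \bar R} := HB.pack out outM.
have cara G : open G -> mu.-caratheodory G.
  by apply: metric_outer_measure_open => A B e; exact: open_outer_metric.
(* Preimages of open sets under the projections are open, hence Caratheodory measurable. So the
   whole product sigma-algebra consists of Caratheodory measurable sets. *)
have mid : measurable_fun setT
    (fun z : caratheodory_type mu => z : (borel X * borel X)%type).
  apply/measurable_fun_pairP; split;
    apply: (@measurability _ _ (caratheodory_type mu) (borel X) setT _ (@open X)) => //.
    move=> _ [U oU <-]; rewrite setTI; apply: cara.
    by apply: open_comp oU => z _; exact: cvg_fst.
  move=> _ [U oU <-]; rewrite setTI; apply: cara.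
  by apply: open_comp oU => z _; exact: cvg_snd.
have sub_cara (A : set (borel X * borel X)) :
    measurable A -> mu.-caratheodory (A : set (X * X)).
  by move=> mA; have := mid measurableT _ mA; rewrite setTI.
pose m : set (borel X * borel X) -> \bar R := out.
have m_add : semi_sigma_additive m.
  move=> F mF tF mUF.
  by apply: (@caratheodory_measure_sigma_additive R _ mu) => // [i|]; exact: sub_cara.
have m1 : m setT = 1%E.
  apply/eqP; rewrite eq_le; apply/andP; split.
    apply: (le_trans (open_outer_le bP openT)); by rewrite lee_fin.
  apply/lee_addgt0Pr => e e0; have [K cK bK] := btight e e0.
  rewrite -leeBlDr//; apply: open_outer_setT_ge => //.
  by exists K.
pose mM := isMeasure.Build _ _ R m (outer_measure0 mu) (outer_measure_ge0 mu) m_add.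
pose m' : {measure set (borel X * borel X)%type -> \bar R} := HB.pack m mM.
pose mP := Measure_isProbability.Build _ _ R m' m1.
pose pi : probability (borel X * borel X)%type R := HB.pack m mM mP.
by exists pi => G; exact: open_outer_le.
Qed.

(** * Borel probabilities on Polish spaces *)

Lemma polish_dense_seq (R : realType) (X : completePseudoMetricType R) :
  polish X -> exists s : nat -> X, forall x (e : R), 0 < e -> exists n, ball (s n) e x.
Proof.
move=> [_ [S [/countable_injP[f injf] dS]]].
(* Inverts the injection [f] of [S] into the integers; indices that it misses receive [point]. *)
exists (fun n => xget point [set x | S x /\ f x = n]) => x e e0.
have [||y [xy Sy]] := dS ((ball x e)°); last first.
- exists (f y); case: xgetP => [z _ [Sz fzy]|/(_ y)/(_ (conj Sy erefl))//].
  rewrite (injf z y) ?inE//.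
  by apply: ball_sym; exact: interior_subset xy.
- exact: open_interior.
- by exists x; apply: nbhs_singleton; apply: nbhs_interior; exact: nbhsx_ballx.
Qed.

(** Separability makes an open set of the product a countable union of open rectangles. This places
    it in the product sigma-algebra, on which couplings live. *)
Lemma open_prod_measurable (R : realType) (X : completePseudoMetricType R) (G : set (X * X)) :
  polish X -> open G -> measurable (G : set (borel X * borel X)).
Proof.
move=> /polish_dense_seq[s sd] oG.
pose B n m i : set (borel X * borel X) :=
  (ball (s n) (radius i : R))° `*` (ball (s m) (radius i : R))°.
pose C n m i := if `[< B n m i `<=` G >] then B n m i else set0.
have -> : G = \bigcup_n \bigcup_m \bigcup_i C n m i :> set (borel X * borel X).
  apply/seteqP; split=> [[x y] Gxy|z [n _ [m _ [i _]]]]; last first.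
    by rewrite /C; case: asboolP => // sub /sub.
  have /nbhs_ballP[e /= e0 eG] : nbhs (x, y) G by exact: open_nbhs_nbhs.
  have e40 : 0 < e / 4 by rewrite divr_gt0.
  have [i ie] := ltr_add_invr e40; rewrite add0r -/(radius i) in ie.
  have r0 : 0 < radius i / 2 :> R by rewrite divr_gt0// radius_gt0.
  have [n nx] := sd x _ r0; have [m my] := sd y _ r0.
  have inB (z w : X) : ball w (radius i / 2) z -> (ball w (radius i : R))° z.
    move=> wz; apply/nbhs_ballP; exists (radius i / 2) => //= v zv.
    by rewrite [radius i]splitr; exact: ball_triangle wz zv.
  exists n => //; exists m => //; exists i => //.
  rewrite /C; case: asboolP; first by move=> _; split; exact: inB.
  case=> -[x' y'] [/= /interior_subset nx' /interior_subset my']; apply: eG.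
  have tri (z w w' : X) : ball z (radius i / 2) w -> ball z (radius i) w' -> ball w e w'.
    move=> zw zw'; apply: (@le_ball _ _ _ (radius i / 2 + radius i)).
      by move: ie e0; lra.
    exact: ball_triangle (ball_sym zw) zw'.
  by split; [exact: tri nx nx'|exact: tri my my'].
do 3 (apply: bigcupT_measurable => ?); rewrite /C; case: ifP => _; last exact: measurable0.
by apply: measurableX; apply: sub_sigma_algebra; exact: open_interior.
Qed.

Lemma ultra_bigcup_ord T (F : set_system T) (B : nat -> set T) n : UltraFilter F ->
  F (\bigcup_(i in `I_n) B i) -> exists i, F (B i).
Proof.
move=> UF; have PF : ProperFilter F by exact: ultra_proper.
elim: n => [|n IH]; first by rewrite II0 bigcup_set0 => /filter_not_empty.
rewrite IIS bigcup_setU bigcup_set1 => FU.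
have [|FnB] := in_ultra_setVsetC (B n) UF; first by exists n.
by apply: IH; apply: filterS (filterI FU FnB) => x [[]].
Qed.

(** Ulam's theorem. For each [n], finitely many balls of radius [radius n] carry all mass but
    [e / 2 ^ n.+1]. The intersection [L] of these finite unions is totally bounded, so its closure
    is compact by completeness. *)
Lemma probability_tight (R : realType) (X : completePseudoMetricType R)
    (P : probability (borel X) R) (e : R) : polish X -> 0 < e ->
  exists2 K : set X, compact K & (P (~` K) <= e%:E)%E /\ closed K.
Proof.
move=> /polish_dense_seq[s sd] e0.
pose U n N : set X := \bigcup_(i in `I_N) (ball (s i) (radius n : R))°.
have mU n N : measurable (U n N : set (borel X)).
  by apply: sub_sigma_algebra; apply: bigcup_open => i _; exact: open_interior.
have UT n : \bigcup_N U n N = setT.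
  apply/seteqP; split => // x _.
  have r0 : 0 < radius n / 2 :> R by rewrite divr_gt0// radius_gt0.
  have [i ix] := sd x _ r0; exists i.+1 => //; exists i => //=.
  apply/nbhs_ballP; exists (radius n / 2) => //= v xv.
  by rewrite [radius n]splitr; exact: ball_triangle ix xv.
have smallN n : exists N, (P (~` U n N) <= (e / (2 ^ n.+1)%:R)%:E)%E.
  have e2 : 0 < e / (2 ^ n.+1)%:R by rewrite divr_gt0// ltr0n expn_gt0.
  have cvgU : P (~` U n N) @[N --> \oo] --> P (\bigcap_N ~` U n N).
    apply: nonincreasing_cvg_mu => //.
    - by rewrite -ge0_fin_numE ?fin_num_measure//; exact: measurableC.
    - by move=> i; exact: measurableC.
    - by apply: bigcapT_measurable => i; exact: measurableC.
    - move=> N M NM; apply/subsetPset; apply: subsetC => x [i /= iN Ui].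
      by exists i => //=; exact: leq_trans iN NM.
  rewrite -setC_bigcup UT setCT measure0 in cvgU.
  have /fine_cvgP[_ /cvgr_lt /(_ _ e2) [N _ /(_ N (leqnn N)) /= lt]] := cvgU.
  exists N; rewrite -[X in (X <= _)%E]fineK ?lee_fin ?ltW//.
  by rewrite fin_num_measure//; exact: measurableC.
have [N NP] := choice smallN.
pose L := \bigcap_n U n (N n).
have mL : measurable (L : set (borel X)) by exact: bigcapT_measurable.
have mK : measurable (closure L : set (borel X)).
  rewrite -[X in measurable X]setCK; apply: measurableC.
  by apply: sub_sigma_algebra; apply: closed_openC; exact: closed_closure.
exists (closure L); last first.
  split; last exact: closed_closure.
  apply: (@le_trans _ _ (P (~` L))).
    by apply: le_measure; rewrite ?inE; [exact: measurableC..|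
      apply: subsetC; exact: subset_closure].
  apply: le_trans (epsilon_trick0 xpredT (ltW e0)).
  apply: (@le_trans _ _ (\sum_(0 <= n <oo) P (~` U n (N n)))%E).
    apply: measure_sigma_subadditive => [n||]; [exact: measurableC..|].
    by rewrite /L setC_bigcap.
  by apply: lee_nneseries => // n _.
rewrite compact_ultra => F UF FK; have PF : ProperFilter F by exact: ultra_proper.
(* A point of the closure is within [radius n] of a point of [L], hence within [2 * radius n < d] of
   one of finitely many centres; an ultrafilter selects one of these balls. *)
have cauchyF : cauchy_ex F.
  move=> d d0; have d20 : 0 < d / 2 by rewrite divr_gt0.
  have [n nd] := ltr_add_invr d20; rewrite add0r -/(radius n) in nd.
  suff : F (\bigcup_(i in `I_(N n)) ball (s i) d).
    by move=> /ultra_bigcup_ord[i Fi]; exists (s i).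
  apply: filterS FK => x /(_ (ball x (radius n : R))).
  case; first by apply: nbhsx_ballx; exact: radius_gt0.
  move=> y [/(_ n I) [i iN /interior_subset iy] xy]; exists i => //.
  apply: (@le_ball _ _ _ (radius n + radius n)); first by move: nd; lra.
  exact: ball_triangle iy (ball_sym xy).
have /cvg_ex[p Fp] : cvg F by apply: cauchy_cvg; exact: cauchy_exP.
exists p; split => //; apply: closed_closure => B /Fp FB.
by have [x []] := filter_ex (filterI FK FB); exists x.
Qed.

(** * Weak limits of couplings *)

Lemma ler_cvg (R : realType) I (F : set_system I) {PF : ProperFilter F}
    (f g : I -> R) (l l' : R) :
  f @ F --> l -> g @ F --> l' -> (\forall i \near F, f i <= g i) -> l <= l'.
Proof.
move=> fl gl fg; rewrite -subr_ge0; apply: (cvgr_to_ge (cvgB gl fl)).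
by apply: filterS fg => i; rewrite subr_ge0.
Qed.

Lemma lsc_prod_measurable (R : realType) (X : completePseudoMetricType R)
    (c : X * X -> \bar R) :
  polish X -> lower_semicontinuous c ->
  measurable_fun setT (c : borel X * borel X -> \bar R).
Proof.
move=> polX lc; apply: (measurability _ (ErealGenOInfty.measurableE R)).
move=> _ [_ [a ->]] <-; rewrite setTI preimage_itvoy.
by apply: open_prod_measurable => //; move/lower_semicontinuousP : lc; exact.
Qed.

Lemma continuous_borel_measurable (R : realType) (X : ptopologicalType) (f : X -> R) :
  continuous f -> measurable_fun setT (f : borel X -> R).
Proof.
move=> cf; apply: (measurability _ (RGenOInfty.measurableE R)).
move=> _ [_ [a ->]] <-; rewrite setTI; apply: sub_sigma_algebra.
by apply: open_comp => [x _|]; [exact: cf|exact: interval_open].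
Qed.

(** A test function between the indicators of [A] and [B], through which weak convergence controls
    measures of sets. *)
Lemma separated_bcfun (R : realType) (X : pseudoPMetricType R) (A B : set X) (e : R) :
  0 < e -> separated_by e A (~` B) ->
  exists f : bcfun R X,
    [/\ forall x, 0 <= proj1_sig f x <= 1, forall x, A x -> proj1_sig f x = 1 &
        forall x, ~ B x -> proj1_sig f x = 0].
Proof.
move=> e0 AB; have : uniform_separator (~` B) A.
  apply: uniform_separatorW; exists [set xy | ball xy.1 e xy.2].
    exact: (entourage_ball X (PosNum e0)).
  rewrite -subset0 => -[x y] [/= [nBx Ay] xy].
  by apply: (AB y x Ay _ nBx); exact: ball_sym.
move=> /(@uniform_separatorP _ R)[f [cf f01 fB fA]].
have f01' x : 0 <= f x <= 1.
  by have := f01 (f x); rewrite /= in_itv/=; apply; exists x.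
have fbc : continuous f /\ exists M : R, forall x, `|f x| <= M.
  by split=> //; exists 1 => x; have /andP[f0 f1] := f01' x; rewrite ger0_norm.
exists (exist _ f fbc); split=> //= x; first by move=> Ax; apply: fA; exists x.
by move=> Bx; apply: fB; exists x.
Qed.

Lemma integrals_bc_bounds (R : realType) (X : pseudoPMetricType R)
    (P : probability (borel X) R) (f : bcfun R X) (A B : set (borel X)) :
  measurable A -> measurable B ->
  (forall x, 0 <= proj1_sig f x <= 1) -> (forall x, A x -> proj1_sig f x = 1) ->
  (forall x, ~ B x -> proj1_sig f x = 0) ->
  fine (P A) <= integrals_bc P f <= fine (P B).
Proof.
move=> mA mB f01 fA fB; case: f f01 fA fB => f [cf bf] /= f01 fA fB.
have mf : measurable_fun setT (EFin \o f : borel X -> \bar R).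
  by apply/measurable_EFinP; exact: continuous_borel_measurable cf.
have m1 (C : set (borel X)) : measurable C ->
    measurable_fun setT (fun x : borel X => (\1_C x : R)%:E).
  by move=> mC; apply/measurable_EFinP; exact: measurable_indic.
have PE (C : set (borel X)) : measurable C -> P C = (\int[P]_x (\1_C x)%:E)%E.
  by move=> mC; rewrite integral_indic// setIT.
have AP : (P A <= \int[P]_x (f x)%:E)%E.
  rewrite PE//; apply: ge0_le_integral => //.
  - exact: m1.
  - move=> x _; rewrite lee_fin indicE; case: (boolP (x \in A)) => [/set_mem/fA ->//|_].
    by case/andP: (f01 x).
have BP : (\int[P]_x (f x)%:E <= P B)%E.
  rewrite PE//; apply: ge0_le_integral => //.
  - by move=> x _; rewrite lee_fin; case/andP: (f01 x).
  - exact: m1.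
  - move=> x _; rewrite lee_fin indicE; case: (boolP (x \in B)) => [_|].
      by case/andP: (f01 x).
    by rewrite notin_setE => /fB ->.
have Bfin : P B \is a fin_num by exact: fin_num_measure.
have fin : (\int[P]_x (f x)%:E)%E \is a fin_num.
  rewrite ge0_fin_numE; first by apply: le_lt_trans BP _; rewrite -ge0_fin_numE.
  exact: le_trans AP.
by rewrite /integrals_bc/= !fine_le// fin_num_measure.
Qed.

Lemma integrals_bc_cvg (R : realType) (X : ptopologicalType) (I : Type) (F : set_system I)
    {FF : Filter F} (p : I -> weakP R X) (p0 : weakP R X) (f : bcfun R X) :
  p @ F --> p0 -> integrals_bc (p i) f @[i --> F] --> integrals_bc p0 f.
Proof.
move=> pp0.
have c1 : continuous (@integrals_bc R X : weakP R X -> _) by exact: initial_continuous.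
have c2 := @proj_continuous {classic bcfun R X} (fun=> R) f.
apply: (cvg_comp _ _ (cvg_comp _ _ pp0 (c1 p0)) (c2 (integrals_bc p0))).
Qed.

(** A portmanteau inequality for sets with a gap: the integral of the separating function is at
    least [p0 A] in the limit and at most [p i B] along the way. [weak_cvg_le] is its dual. *)
Lemma weak_cvg_ge (R : realType) (X : pseudoPMetricType R) (I : Type) (F : set_system I)
    {PF : ProperFilter F} (p : I -> weakP R X) (p0 : weakP R X)
    (A B : set (borel X)) (e l : R) :
  p @ F --> p0 -> measurable A -> measurable B ->
  0 < e -> separated_by e (A : set X) (~` B) ->
  fine ((p i : probability (borel X) R) B) @[i --> F] --> l ->
  fine ((p0 : probability (borel X) R) A) <= l.
Proof.
move=> pp0 mA mB e0 AB pl; have [f [f01 fA fB]] := separated_bcfun e0 AB.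
have /andP[le0 _] := integrals_bc_bounds p0 mA mB f01 fA fB.
apply: (le_trans le0); apply: (ler_cvg (integrals_bc_cvg (f := f) pp0) pl).
by apply: nearW => i; have /andP[] := integrals_bc_bounds (p i) mA mB f01 fA fB.
Qed.

Lemma weak_cvg_le (R : realType) (X : pseudoPMetricType R) (I : Type) (F : set_system I)
    {PF : ProperFilter F} (p : I -> weakP R X) (p0 : weakP R X)
    (A B : set (borel X)) (e l : R) :
  p @ F --> p0 -> measurable A -> measurable B ->
  0 < e -> separated_by e (A : set X) (~` B) ->
  fine ((p i : probability (borel X) R) A) @[i --> F] --> l ->
  l <= fine ((p0 : probability (borel X) R) B).
Proof.
move=> pp0 mA mB e0 AB pl; have [f [f01 fA fB]] := separated_bcfun e0 AB.
have /andP[_ le0] := integrals_bc_bounds p0 mA mB f01 fA fB.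
apply: le_trans le0; apply: (ler_cvg pl (integrals_bc_cvg (f := f) pp0)).
by apply: nearW => i; have /andP[] := integrals_bc_bounds (p i) mA mB f01 fA fB.
Qed.

(** Exhausts [U] from within, keeping at every stage the gap that [weak_cvg_le] requires. *)
Lemma open_increasing_approx (R : realType) (X : pseudoPMetricType R) (U : set X) :
  open U -> exists V : nat -> set X,
    [/\ forall n, open (V n), {homo V : n m / (n <= m)%N >-> n `<=` m},
        \bigcup_n V n = U & forall n, separated_by (radius n : R) (V n) (~` U)].
Proof.
move=> oU; exists (fun n => (ball_interior U (radius n : R))°); split.
- by move=> n; exact: open_interior.
- move=> n m nm; apply: interiorS; apply: ball_interior_mono; exact: ler_radius.
- apply/seteqP; split=> [z [n _ /interior_subset]|z Uz].
    by apply; apply: ballxx; exact: radius_gt0.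
  have /nbhs_ballP[e /= e0 eU] : nbhs z U by exact: open_nbhs_nbhs.
  have e20 : 0 < e / 2 by rewrite divr_gt0.
  have [n ne] := ltr_add_invr e20; rewrite add0r -/(radius n) in ne.
  exists n => //; apply/nbhs_ballP; exists (e / 2) => //= v zv w vw; apply: eU.
  apply: (@le_ball _ _ _ (e / 2 + radius n)); first by move: ne; lra.
  exact: ball_triangle zv vw.
- by move=> n x y /interior_subset Vx xy; apply; exact: Vx.
Qed.

(** Both total masses are 1, so the inequality reverses on closed sets. Applied to closures of an
    exhaustion of [U], this gives equality on open sets, a generating class closed under
    intersection. *)
Lemma probability_eq_open (R : realType) (X : pseudoPMetricType R)
    (P Q : probability (borel X) R) :
  (forall U : set X, open U -> (P U <= Q U)%E) ->
  forall A : set (borel X), measurable A -> P A = Q A.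
Proof.
move=> PQ; have mo (U : set X) : open U -> measurable (U : set (borel X)).
  exact: sub_sigma_algebra.
have QP (U : set X) : open U -> (Q U <= P U)%E.
  move=> oU; have [V [oV Vmono <- VU]] := open_increasing_approx oU.
  have cvgQ : Q (V n) @[n --> \oo] --> Q (\bigcup_n V n).
    apply: nondecreasing_cvg_mu => [i||n m nm]; first exact: mo.
      by apply: bigcupT_measurable => i; exact: mo.
    by apply/subsetPset; exact: Vmono.
  apply: cvge_le cvgQ; apply: nearW => n.
  have mcl : measurable (~` closure (V n) : set (borel X)).
    by apply: mo; apply: closed_openC; exact: closed_closure.
  have mcl' : measurable (closure (V n) : set (borel X)).
    by rewrite -[X in measurable X]setCK; exact: measurableC.
  apply: (@le_trans _ _ (Q (closure (V n)))).
    by apply: le_measure; rewrite ?inE//; [exact: mo|exact: subset_closure].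
  apply: (@le_trans _ _ (P (closure (V n)))).
    rewrite -(setCK (closure (V n))) (probability_setC Q)// (probability_setC P)//.
    by apply: leeB => //; apply: PQ; apply: closed_openC; exact: closed_closure.
  apply: le_measure; rewrite ?inE//; first by apply: bigcupT_measurable => i; exact: mo.
  move=> x /(_ (ball x (radius n : R))) [|y [Vy xy]].
    by apply: nbhsx_ballx; exact: radius_gt0.
  by apply: contrapT; exact: VU Vy (ball_sym xy).
apply: (@measure_unique _ _ (borel X) (@open X) (fun=> setT)) => //.
- by move=> U V; exact: openI.
- by move=> _; exact: openT.
- by rewrite bigcup_const.
- by move=> U oU; apply/eqP; rewrite eq_le PQ// QP.
- by move=> _; rewrite -ge0_fin_numE// fin_num_measure.
Qed.

Lemma ultra_cvg_unit_interval (R : realType) I (F : set_system I) (g : I -> R) :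
  UltraFilter F -> (forall i, 0 <= g i <= 1) -> exists l : R, g @ F --> l.
Proof.
move=> UF g01; have PF : ProperFilter F by exact: ultra_proper.
have [|p [_ clp]] := @segment_compact R 0 1 (fmap g F) _.
  by apply: nearW => i; rewrite /= in_itv/=.
exists p => U pU; have [//|FnU] := in_ultra_setVsetC (g @^-1` U) UF.
by have [r []] := clp (~` U) U FnU pU.
Qed.

Section real_valued_probability.
Variables (d : measure_display) (T : measurableType d) (R : realType) (P : probability T R).

Let fineE (A : set T) : measurable A -> (fine (P A))%:E = P A.
Proof. by move=> mA; rewrite fineK// fin_num_measure. Qed.

Lemma fine_probability_bounds (A : set T) : measurable A -> 0 <= fine (P A) <= 1.
Proof.
by move=> mA; rewrite fine_ge0//= -lee_fin fineE//; exact: probability_le1.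
Qed.

Lemma le_fine_probability (A B : set T) : measurable A -> measurable B -> A `<=` B ->
  fine (P A) <= fine (P B).
Proof. by move=> mA mB AB; rewrite -lee_fin !fineE//; apply: le_measure; rewrite ?inE. Qed.

Lemma fine_probability_setUI (A B : set T) : measurable A -> measurable B ->
  fine (P A) + fine (P B) = fine (P (A `|` B)) + fine (P (A `&` B)).
Proof.
move=> mA mB; apply: EFin_inj; rewrite !EFinD !fineE//.
- rewrite measureUfinl//; last by rewrite -ge0_fin_numE// fin_num_measure.
  by rewrite subeK// fin_num_measure//; exact: measurableI.
- exact: measurableI.
- exact: measurableU.
Qed.

End real_valued_probability.

(** A tube lemma with a uniform gap, as needed for [weak_cvg_ge]: by compactness one radius works
    for all balls around points of [K] times [L], and balls of the product are products of balls. *)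
Lemma compact_setX_ball_neighborhood (R : realType) (X : pseudoPMetricType R)
    (K L : set X) (W : set (X * X)) : compact K -> compact L -> open W -> K `*` L `<=` W ->
  exists N M : set X, exists2 e : R, 0 < e &
    [/\ open N, open M, separated_by e K (~` N), separated_by e L (~` M) & N `*` M `<=` W].
Proof.
move=> cK cL oW KLW; have /compact_near_coveringP cKL := compact_setX cK cL.
have [n _ /(_ n (leqnn n)) KLn] :
    \forall n \near \oo, K `*` L `<=` ball_interior W (radius n : R).
  apply: cKL => z /KLW Wz.
  have /nbhs_ballP[e /= e0 eW] : nbhs z W by exact: open_nbhs_nbhs.
  have e20 : 0 < e / 2 by rewrite divr_gt0.
  have [n ne] := ltr_add_invr e20; rewrite add0r -/(radius n) in ne.
  exists (ball z (e / 2), [set m | (n <= m)%N]).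
    by split; [exact: nbhsx_ballx|exists n].
  move=> [z' m] [/= zz' nm] w z'w; apply: eW.
  apply: (@le_ball _ _ _ (e / 2 + radius m)); last exact: ball_triangle zz' z'w.
  by have := ler_radius R nm; move: ne; lra.
pose N (C : set X) := \bigcup_(x in C) (ball x (radius n : R))°.
have r0 : 0 < radius n / 2 :> R by rewrite divr_gt0// radius_gt0.
have sepN (C : set X) : separated_by (radius n / 2) C (~` N C).
  move=> x y Cx xy; apply; exists x => //; apply/nbhs_ballP.
  exists (radius n / 2) => //= v yv.
  by rewrite [radius n]splitr; exact: ball_triangle xy yv.
have oN C : open (N C) by apply: bigcup_open => x _; exact: open_interior.
exists (N K), (N L), (radius n / 2) => //; split=> //.
move=> [x y] [[x' Kx' /interior_subset xx'] [y' Ly' /interior_subset yy']].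
by apply: (KLn (x', y')).
Qed.

(** The ultrafilter limit of [pi i] is an open content [b], and [pi0] is the measure that
    [open_content_measure] extracts from it. The number [l] is [b G]. *)
Lemma coupling_limit (R : realType) (X : completePseudoMetricType R) I (F : set_system I)
    (eta nu : I -> probability (borel X) R)
    (pi : I -> probability (borel X * borel X)%type R)
    (eta0 nu0 : probability (borel X) R) :
  polish X -> UltraFilter F ->
  (eta : I -> weakP R X) @ F --> (eta0 : weakP R X) ->
  (nu : I -> weakP R X) @ F --> (nu0 : weakP R X) ->
  (forall i, coupling (eta i) (nu i) (pi i)) ->
  exists2 pi0 : probability (borel X * borel X)%type R, coupling eta0 nu0 pi0 &
    forall G : set (X * X), open G ->
      exists2 l : R, fine (pi i G) @[i --> F] --> l & fine (pi0 G) <= l.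
Proof.
move=> polX UF etaF nuF cpl; have PF : ProperFilter F by exact: ultra_proper.
have mO (G : set (X * X)) : open G -> measurable (G : set (borel X * borel X)).
  exact: open_prod_measurable.
have mo (U : set X) : open U -> measurable (U : set (borel X)) by exact: sub_sigma_algebra.
(* Nonmeasurable sets receive 0, because [open_content] asks for nonnegativity on all sets. *)
have /choice[b b_lim] (A : set (borel X * borel X)) :
    exists l : R, 0 <= l /\ (measurable A -> fine (pi i A) @[i --> F] --> l).
  have [mA|nmA] := pselect (measurable A); last by exists 0; split.
  have [|l Al] := @ultra_cvg_unit_interval R I F (fun i => fine (pi i A)) UF.
    by move=> i; exact: fine_probability_bounds.
  exists l; split => //; apply: (cvgr_to_ge Al); apply: nearW => i.
  by have /andP[] := fine_probability_bounds (pi i) mA.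
have b_cvg A : measurable A -> fine (pi i A) @[i --> F] --> b A by case: (b_lim A).
have b_setUI A B : measurable A -> measurable B -> b A + b B = b (A `|` B) + b (A `&` B).
  move=> mA mB.
  have L : (fine (pi i A) + fine (pi i B)) @[i --> F] --> b A + b B.
    by apply: cvgD; exact: b_cvg.
  have L' : (fine (pi i A) + fine (pi i B)) @[i --> F] --> b (A `|` B) + b (A `&` B).
    under eq_fun do rewrite fine_probability_setUI//.
    by apply: cvgD; apply: b_cvg; [exact: measurableU|exact: measurableI].
  exact: (cvg_unique (@Rhausdorff R) L L').
have b_mono A B : measurable A -> measurable B -> A `<=` B -> b A <= b B.
  move=> mA mB AB; apply: (ler_cvg (b_cvg _ mA) (b_cvg _ mB)).
  by apply: nearW => i; exact: le_fine_probability.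
have b_cst A r : measurable A -> (forall i, fine (pi i A) = r) -> b A = r.
  move=> mA Ar; have := b_cvg _ mA; under eq_fun do rewrite Ar.
  by move=> L; exact: (cvg_unique (@Rhausdorff R) L (cvg_cst r)).
have bP : open_content (b : set (X * X) -> R).
  split.
  - by apply: b_cst => // i; rewrite measure0.
  - by move=> A; case: (b_lim A).
  - by move=> A B oA oB; apply: b_mono; exact: mO.
  - move=> A B oA oB AB0; rewrite b_setUI; [|exact: mO..].
    by rewrite AB0 (b_cst set0 0) ?addr0// => i; rewrite measure0.
  - move=> A B oA oB; rewrite b_setUI; [|exact: mO..].
    by rewrite lerDl; case: (b_lim (A `&` B)).
have bT : b setT = 1.
  by apply: b_cst => // i; rewrite probability_setT.
have mfst (A : set (borel X)) : measurable A ->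
    measurable (fst @^-1` A : set (borel X * borel X)).
  by move=> mA; rewrite -[X in measurable X]setTI; exact: measurable_fst.
have msnd (A : set (borel X)) : measurable A ->
    measurable (snd @^-1` A : set (borel X * borel X)).
  by move=> mA; rewrite -[X in measurable X]setTI; exact: measurable_snd.
have eta_cvg (A : set (borel X)) : measurable A ->
    fine (eta i A) @[i --> F] --> b (fst @^-1` A).
  move=> mA; have := b_cvg _ (mfst _ mA).
  by under eq_fun do rewrite (cpl _).1//.
have nu_cvg (A : set (borel X)) : measurable A ->
    fine (nu i A) @[i --> F] --> b (snd @^-1` A).
  move=> mA; have := b_cvg _ (msnd _ mA).
  by under eq_fun do rewrite (cpl _).2//.
have mclosed (K : set X) : closed K -> measurable (K : set (borel X)).
  by move=> cK; rewrite -[X in measurable X]setCK; apply: measurableC; apply: mo; exact: closed_openC.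
have fine_setC (P : probability (borel X) R) (K : set X) e : closed K -> (P (~` K) <= e%:E)%E ->
    1 - e <= fine (P K).
  move=> cK; rewrite (probability_setC P (mclosed _ cK)).
  rewrite -[X in (_ - X)%E]fineK ?fin_num_measure//; last exact: mclosed.
  by rewrite -EFinB lee_fin; lra.
(* The cylinders over [N] and [M] each have [b]-mass at least [1 - e / 2]. By inclusion-exclusion
   their intersection, which lies in [W], has at least [1 - e]. *)
have btight (e : R) : 0 < e -> exists2 K : set (X * X), compact K &
    forall W, open W -> K `<=` W -> 1 - e <= b W.
  move=> e0; have e20 : 0 < e / 2 by rewrite divr_gt0.
  have [K cK [etaK clK]] := probability_tight eta0 polX e20.
  have [L cL [nuL clL]] := probability_tight nu0 polX e20.
  exists (K `*` L); first exact: compact_setX.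
  move=> W oW KLW.
  have [N [M [r r0 [oN oM KN LM NMW]]]] := compact_setX_ball_neighborhood cK cL oW KLW.
  have bN : 1 - e / 2 <= b (fst @^-1` N).
    apply: (le_trans (fine_setC _ _ _ clK etaK)).
    exact: (weak_cvg_ge etaF (mclosed _ clK) (mo _ oN) r0 KN (eta_cvg _ (mo _ oN))).
  have bM : 1 - e / 2 <= b (snd @^-1` M).
    apply: (le_trans (fine_setC _ _ _ clL nuL)).
    exact: (weak_cvg_ge nuF (mclosed _ clL) (mo _ oM) r0 LM (nu_cvg _ (mo _ oM))).
  have mN := mfst _ (mo _ oN); have mM := msnd _ (mo _ oM).
  have b1 : b (fst @^-1` N `|` snd @^-1` M) <= 1.
    by rewrite -bT; apply: b_mono => //; exact: measurableU.
  have bW : b (fst @^-1` N `&` snd @^-1` M) <= b W.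
    by apply: b_mono; [exact: measurableI|exact: mO|exact: NMW].
  by have := b_setUI _ _ mN mM; move: bN bM b1 bW; lra.
have [|pi0 pi0b] := open_content_measure bP _ btight; first by rewrite bT.
exists pi0; last first.
  move=> G oG; exists (b G); first by apply: b_cvg; exact: mO.
  by rewrite -lee_fin fineK ?pi0b// fin_num_measure//; exact: mO.
(* By [probability_eq_open] it is enough to bound the marginal of [pi0] by [p0] on open [U]. On each
   [V n] it is at most the limit of [p i (V n)], which the gap bounds by [p0 U]. *)
have marginal (f : borel X * borel X -> borel X) (p : I -> probability (borel X) R)
    (p0 : probability (borel X) R) : measurable_fun setT f ->
    continuous (f : X * X -> X) ->
    (p : I -> weakP R X) @ F --> (p0 : weakP R X) ->
    (forall A, measurable A -> fine (p i A) @[i --> F] --> b (f @^-1` A)) ->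
    forall A, measurable A -> pi0 (f @^-1` A) = p0 A.
  move=> mf cf pp0 pb.
  pose fm : {mfun (borel X * borel X)%type >-> borel X} :=
    HB.pack f (isMeasurableFun.Build _ _ _ _ f mf).
  apply: (@probability_eq_open R X (distribution pi0 fm) p0) => U oU.
  have [V [oV Vmono <- VU]] := open_increasing_approx oU.
  have cvgV : distribution pi0 fm (V n) @[n --> \oo] --> distribution pi0 fm (\bigcup_n V n).
    apply: nondecreasing_cvg_mu => [i||n m nm]; first exact: mo.
      by apply: bigcupT_measurable => i; exact: mo.
    by apply/subsetPset; exact: Vmono.
  apply: cvge_le cvgV; apply: nearW => n.
  have ofV : open (f @^-1` V n : set (X * X)) by apply: open_comp => // z _; exact: cf.
  apply: (le_trans (pi0b _ ofV)).
  have mU : measurable (\bigcup_n V n : set (borel X)) by apply: bigcupT_measurable => i; exact: mo.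
  rewrite -[leRHS]fineK ?fin_num_measure// lee_fin.
  exact: (weak_cvg_le pp0 (mo _ (oV n)) mU (radius_gt0 R n) (VU n) (pb _ (mo _ (oV n)))).
split=> A mA; apply: marginal mA.
- exact: measurable_fst.
- by move=> z; exact: cvg_fst.
- exact: etaF.
- exact: eta_cvg.
- exact: measurable_snd.
- by move=> z; exact: cvg_snd.
- exact: nuF.
- exact: nu_cvg.
Qed.

(** * Semicontinuity of the cost *)

Section level_sums.
Variables (R : realType) (T : Type) (c : T -> \bar R) (h : R).
Hypotheses (c_ge0 : forall z, (0 <= c z)%E) (h_gt0 : 0 < h).

Definition level (k : nat) : set T := [set z | ((k%:R * h)%:E < c z)%E].

(** A Riemann sum of mesh [h] for the layer-cake formula. It lies between the truncation of [c] at
    height [N * h] and [c + h]. *)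
Definition level_sum (N : nat) (z : T) : R := \sum_(k < N) h * \1_(level k) z.

Lemma level_sum_ge0 N z : 0 <= level_sum N z.
Proof. by apply: sumr_ge0 => k _; rewrite mulr_ge0// ltW. Qed.

Lemma level_sumS N z : level_sum N.+1 z = level_sum N z + h * \1_(level N) z.
Proof. exact: big_ord_recr. Qed.

Lemma min_le_level_sum N z : (mine (c z) (N%:R * h)%:E <= (level_sum N z)%:E)%E.
Proof.
elim: N => [|N IH]; first by rewrite mul0r ge_min lee_fin level_sum_ge0 orbT.
rewrite level_sumS indicE; case: (boolP (z \in level N)) => [/set_mem zN|zN].
  rewrite ge_min mulr1 EFinD; apply/orP; right.
  rewrite min_r in IH; last exact: ltW.
  rewrite -natr1 mulrDl mul1r EFinD; exact: leeD.
have cN : (c z <= (N%:R * h)%:E)%E by move: zN; rewrite notin_setE /level/= => /negP; rewrite -leNgt.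
by rewrite mulr0 addr0 ge_min; rewrite min_l// in IH; rewrite IH.
Qed.

Lemma level_sum_le_mul N z : level_sum N z <= N%:R * h.
Proof.
elim: N => [|N IH]; first by rewrite /level_sum big_ord0 mul0r.
rewrite level_sumS -natr1 mulrDl mul1r lerD// indicE.
by case: (z \in _); rewrite ?mulr1 ?mulr0// ltW.
Qed.

(** The term of index [N] is added only where [c] exceeds [N * h], and there the preceding terms sum
    to at most [N * h]. *)
Lemma level_sum_le N z : ((level_sum N z)%:E <= c z + h%:E)%E.
Proof.
elim: N => [|N IH]; first by rewrite /level_sum big_ord0 adde_ge0// lee_fin ltW.
rewrite level_sumS indicE; case: (boolP (z \in level N)) => [/set_mem zN|_]; last first.
  by rewrite mulr0 addr0.
by rewrite mulr1 EFinD leeD2r// (le_trans _ (ltW zN))// lee_fin level_sum_le_mul.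
Qed.

End level_sums.

Lemma integral_level_sum (d : measure_display) (T : measurableType d) (R : realType)
    (P : probability T R) (c : T -> \bar R) (h : R) N : 0 < h ->
  (forall k, measurable (level c h k)) ->
  (\int[P]_z (level_sum c h N z)%:E)%E = (\sum_(k < N) h * fine (P (level c h k)))%:E.
Proof.
move=> h0 mc; under eq_integral do rewrite /level_sum -sumEFin.
rewrite ge0_integral_sum//.
- rewrite -sumEFin; apply: eq_bigr => k _.
  under eq_integral do rewrite EFinM.
  rewrite ge0_integralZl//; last 2 first.
  + by apply/measurable_EFinP; exact: measurable_indic.
  + by rewrite lee_fin ltW.
  by rewrite integral_indic// setIT EFinM fineK// fin_num_measure.
- by move=> k; apply/measurable_EFinP; apply: measurable_funM => //; exact: measurable_indic.
- by move=> k z _; rewrite lee_fin mulr_ge0// ltW.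
Qed.

Lemma mine_natr_cvg (R : realType) (x : \bar R) : (0 <= x)%E ->
  mine x n%:R%:E @[n --> \oo] --> x.
Proof.
case: x => [r _||//]; last first.
  move=> _; under eq_fun do rewrite min_r ?leey//.
  by apply/cvgeyPge => A; near=> n; rewrite lee_fin; near: n; exact: nbhs_infty_ger.
apply: cvg_near_cst; near=> n; rewrite min_l// lee_fin.
by near: n; exact: nbhs_infty_ger.
Unshelve. all: by end_near. Qed.

(* No Fatou lemma holds along an ultrafilter, so [c] is compared with finite
   combinations of indicators of the open sets [level c h k]. *)
Lemma lsc_integral_limit (R : realType) (X : completePseudoMetricType R)
    (c : X * X -> \bar R) I (F : set_system I) {PF : ProperFilter F}
    (pi : I -> probability (borel X * borel X)%type R)
    (pi0 : probability (borel X * borel X)%type R) (t : R) :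
  polish X -> (forall z, (0 <= c z)%E) -> lower_semicontinuous c ->
  (forall G : set (X * X), open G ->
     exists2 l : R, fine (pi i G) @[i --> F] --> l & fine (pi0 G) <= l) ->
  (forall i, (\int[pi i]_z c z <= t%:E)%E) -> (\int[pi0]_z c z <= t%:E)%E.
Proof.
move=> polX c0 lc pil ct.
have mc : measurable_fun setT (c : borel X * borel X -> \bar R).
  exact: lsc_prod_measurable.
have olevel h k : open (level c h k : set (X * X)).
  by move/lower_semicontinuousP : lc; exact.
have mlevel h k : measurable (level c h k : set (borel X * borel X)).
  exact: open_prod_measurable.
have msum h N : measurable_fun setT
    (fun z : borel X * borel X => (level_sum c h N z)%:E).
  apply/measurable_EFinP; apply: measurable_sum => k.
  by apply: measurable_funM => //; exact: measurable_indic.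
have bound h N : 0 < h -> (\int[pi0]_z (level_sum c h N z)%:E <= (t + h)%:E)%E.
  move=> h0; rewrite integral_level_sum// lee_fin.
  have /choice[l lP] (k : nat) : exists l : R,
      fine (pi i (level c h k)) @[i --> F] --> l /\ fine (pi0 (level c h k)) <= l.
    by have [l] := pil _ (olevel h k); exists l.
  apply: (@le_trans _ _ (\sum_(k < N) h * l k)).
    by apply: ler_sum => k _; rewrite ler_pM2l//; case: (lP k).
  have lim : (\sum_(k < N) h * fine (pi i (level c h k))) @[i --> F] -->
      \sum_(k < N) h * l k.
    apply: cvg_big => [|k _]; first exact: add_continuous.
    by apply: cvgM; [exact: cvg_cst|case: (lP k)].
  apply: (cvgr_to_le lim); apply: nearW => i.
  rewrite -lee_fin -integral_level_sum//.
  apply: (@le_trans _ _ (\int[pi i]_z (c z + h%:E))%E).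
    apply: ge0_le_integral => //.
    - by move=> z _; rewrite lee_fin level_sum_ge0.
    - by apply: emeasurable_funD.
    - by move=> z _; exact: level_sum_le.
  rewrite ge0_integralD//; last by move=> z _; rewrite lee_fin ltW.
  suff -> : (\int[pi i]__ h%:E)%E = h%:E by rewrite EFinD; apply: leeD2r; exact: ct.
  rewrite integral_cst// -[RHS]mule1; congr (_ * _)%E; exact: probability_setT.
have mmin n : measurable_fun setT
    (fun z : borel X * borel X => mine (c z) n%:R%:E).
  by apply: measurable_mine.
have minbound n : (\int[pi0]_z mine (c z) n%:R%:E <= (t + radius n)%:E)%E.
  (* With mesh [1 / (n + 1)], [n * (n + 1)] levels reach height exactly [n]. *)
  apply: le_trans (bound (radius n) (n * n.+1)%N (radius_gt0 R n)).
  apply: ge0_le_integral => //.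
  - by move=> z _; rewrite le_min c0 lee_fin ler0n.
  - move=> z _; have := min_le_level_sum c (radius_gt0 R n) (n * n.+1) z.
    by rewrite natrM /radius mulfK// pnatr_eq0.
have cvgmin := @cvg_monotone_convergence _ _ _ pi0 setT measurableT _ mmin _ _.
have {}cvgmin : (\int[pi0]_z mine (c z) n%:R%:E)%E @[n --> \oo] --> (\int[pi0]_z c z)%E.
  have -> : (\int[pi0]_z c z)%E = (\int[pi0]_z limn (fun n => mine (c z) n%:R%:E))%E.
    by apply: eq_integral => z _; apply/esym/cvg_lim => //; exact: mine_natr_cvg.
  apply: cvgmin => [n z _|z _ n m nm]; first by rewrite le_min c0 lee_fin ler0n.
  by rewrite le_min ge_min lexx/= ge_min lee_fin ler_nat nm orbT.
apply/lee_addgt0Pr => e e0.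
apply: (cvge_le _ cvgmin); have [N Ne] := ltr_add_invr (e0 : 0 < e).
rewrite add0r in Ne; exists N => // n /= Nn; apply: (le_trans (minbound n)).
by rewrite -EFinD lee_fin lerD2l (le_trans (ler_radius R Nn))// ltW.
Qed.

Lemma lte_EFin_dense (R : realType) (a : R) (x : \bar R) : (a%:E < x)%E ->
  exists2 b : R, a < b & (b%:E < x)%E.
Proof.
case: x => [r||//]; last by exists (a + 1); rewrite ?ltrDl ?ltry.
by rewrite lte_fin => ar; exists ((a + r) / 2); rewrite ?lte_fin; lra.
Qed.

Lemma ot_cost_ge0 (R : realType) (X : ptopologicalType) (c : X * X -> \bar R)
    (eta nu : probability (borel X) R) :
  (forall z, (0 <= c z)%E) -> (0 <= ot_cost c eta nu)%E.
Proof.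
by move=> c0; apply: le_ereal_inf_tmp => _ [pi _ <-]; exact: integral_ge0.
Qed.

Lemma ot_cost_lsc (R : realType) (X : completePseudoMetricType R) (c : X * X -> \bar R)
    (eta0 nu0 : weakP R X) (t : R) :
  polish X -> (forall z, (0 <= c z)%E) -> lower_semicontinuous c ->
  (t%:E < ot_cost c eta0 nu0)%E ->
  \forall eta \near eta0 & nu \near nu0, (t%:E < ot_cost c eta nu)%E.
Proof.
(* Marginals of cost at most [t] have a coupling of cost at most [t'], whether or not the infimum is
   attained. *)
move=> polX c0 lc /lte_EFin_dense[t' tt' t'C]; apply: contrapT => nlsc.
pose J := {p : probability (borel X) R * probability (borel X) R *
              probability (borel X * borel X)%type R |
            coupling p.1.1 p.1.2 p.2 /\ (\int[p.2]_z c z <= t'%:E)%E}.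
pose eta (i : J) : weakP R X := (sval i).1.1.
pose nu (i : J) : weakP R X := (sval i).1.2.
(* The neighbourhood filter of [(eta0, nu0)] pulled back to the cheap couplings. Failure of
   semicontinuity makes it proper, so it extends to an ultrafilter. *)
pose F : set_system J := filter_from
  [set UV : set (weakP R X) * set (weakP R X) | nbhs eta0 UV.1 /\ nbhs nu0 UV.2]
  (fun UV => [set i | UV.1 (eta i) /\ UV.2 (nu i)]).
have PF : ProperFilter F.
  apply: filter_from_proper => [|[U V] [/= etaU nuV]].
    apply: filter_from_filter; first by exists (setT, setT); split; exact: filterT.
    move=> [U V] [U' V'] [/= etaU nuV] [/= etaU' nuV'].
    exists (U `&` U', V `&` V'); first by split; exact: filterI.
    by move=> i [/= [? ?] [? ?]].
  have [p [Up Vp nCp]] : exists p, [/\ U p.1, V p.2 & ~ (t%:E < ot_cost c p.1 p.2)%E].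
    apply: contrapT => nex; apply: nlsc; exists (U, V) => // p [/= Up Vp].
    by apply: contrapT => nCp; apply: nex; exists p.
  have : (ot_cost c p.1 p.2 < t'%:E)%E.
    by move/negP : nCp; rewrite -leNgt => /le_lt_trans; apply; rewrite lte_fin.
  move=> /ereal_inf_lt[_ [pi cpl <-] /ltW pit'].
  by exists (exist _ (p, pi) (conj cpl pit')).
have [G [UG FG]] := ultraFilterLemma PF.
have PG : ProperFilter G by exact: ultra_proper.
have etaG : eta @ G --> eta0.
  move=> U etaU; apply: FG; exists (U, setT); first by split => //; exact: filterT.
  by move=> i [].
have nuG : nu @ G --> nu0.
  move=> V nuV; apply: FG; exists (setT, V); first by split => //; exact: filterT.
  by move=> i [].
have [pi0 cpl0 pi0_lim] := coupling_limit polX UG etaG nuG (fun i => (svalP i).1).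
have cost0 := lsc_integral_limit polX c0 lc pi0_lim (fun i => (svalP i).2).
have : (t'%:E < \int[pi0]_z c z)%E.
  by apply: (lt_le_trans t'C); apply: ereal_inf_lbound; exists pi0.
by rewrite ltNge cost0.
Qed.

(** * Lower semicontinuity of [Dc] *)

Unset Implicit Arguments.
Set Strict Implicit.
Set Printing Implicit Defensive.

Theorem theorem3 (R : realType) (X : completePseudoMetricType R)
  (D : probability (borel X) R -> probability (borel X) R -> \bar R)
  (c : X * X -> \bar R) (mu : probability (borel X) R) :
  polish X ->
  (forall P Q, (0 <= D P Q)%E) -> (forall P, D P P = 0%E) ->
  (forall z, (0 <= c z)%E) -> lower_semicontinuous c ->
  lower_semicontinuous (fun P : weakP R X => D P mu) ->
  (forall t : R, compact [set P : weakP R X | (D P mu <= t%:E)%E]) ->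
  lower_semicontinuous (fun nu : weakP R X => Dc D c nu mu).
Proof.
(* An infimum of values above [b] is only known to be at least [b], so [b] is taken strictly above
   [a]. *)
move=> polX D0 _ c0 lc lD cD nu0 a /lte_EFin_dense[b ab bDc].
have /compact_near_coveringP cK := cD b.
(* Where [D P mu] exceeds [b], nonnegativity of the cost suffices, so only [P] in the compact
   sublevel set constrains [nu]. *)
exists [set nu : weakP R X | forall P : weakP R X,
    (D P mu <= b%:E)%E -> (b%:E < D P mu + ot_cost c P nu)%E]; last first.
  move=> nu nuP; apply: (@lt_le_trans _ _ b%:E); first by rewrite lte_fin.
  apply: le_ereal_inf_tmp => _ [P _ <-].
  have [/nuP/ltW//|/ltW bP] := leP (D P mu) b%:E.
  by rewrite (le_trans bP)// leeDl// ot_cost_ge0.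
(* The tube argument: near-covering compactness along [nbhs nu0] reduces the claim to neighbourhoods
   of a single [P] and of [nu0]. *)
apply: (cK _ (nbhs nu0) (fun nu P => (b%:E < D P mu + ot_cost c P nu)%E)) => P /= DPb.
have bP : (b%:E < D P mu + ot_cost c P nu0)%E.
  by apply: (lt_le_trans bDc); apply: ereal_inf_lbound; exists P.
have [d [e [dD eC <-]]] : exists d e : R,
    [/\ (d%:E < D P mu)%E, (e%:E < ot_cost c P nu0)%E & d + e = b].
  (* [D P mu] is finite, being at most [b]. If the cost is finite, each summand gives up half of the
     slack [x + y - b]; if it is [+oo], [d] is [x - 1] and [e] is the remainder. *)
  move: bP DPb (D0 P mu) (ot_cost_ge0 P nu0 c0).
  case: (D P mu) => [x||]//; case: (ot_cost c P nu0) => [y||]//.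
    rewrite -EFinD lte_fin => bxy _ _ _.
    exists (x - (x + y - b) / 2), (y - (x + y - b) / 2); rewrite !lte_fin.
    by split; lra.
  move=> _ _ _ _; exists (x - 1), (b - x + 1); rewrite lte_fin ltry.
  by split=> //; lra.
have [V PV VD] := lD P d dD.
have [[U W] [/= PU nuW] UW] := ot_cost_lsc polX c0 lc eC.
exists (V `&` U, W); first by split => //; exact: filterI.
move=> [Q nu] [/= [VQ UQ] Wnu].
by rewrite EFinD lteD//; [exact: VD|exact: (UW (Q, nu))].
Qed.
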